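(* Let $G$ be a finite, simple, connected unicyclic graph whose unique cycle has length $\ell$, and suppose exactly $k\ge 2$ vertices of the cycle have degree at least $3$ in $G$. If both $k$ and $\ell$ are even, then $\mathrm{mob}(G)\le \frac{k}{2}+2$. Moreover this bound is tight: there exist such graphs (with $k,\ell$ even) for which $\mathrm{mob}(G)=\frac{k}{2}+2$.
   Context: A unicyclic graph is a connected graph containing exactly one cycle. A set $S$ of vertices is a general position set if no three distinct vertices of $S$ lie on a common shortest path. Place one robot on each vertex of a general position set $S$; robots move one at a time, and a move is legal if a robot moves to an adjacent unoccupied vertex and the new set of occupied vertices is again a general position set. $S$ is a mobile general position set if some finite sequence of legal moves results in every vertex of $G$ being occupied by some robot at some moment. $\mathrm{mob}(G)$ is the maximum cardinality of a mobile general position set of $G$. *)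

(* Defs.v *)
From mathcomp Require Import all_boot.
Set Implicit Arguments. Unset Strict Implicit. Unset Printing Implicit Defensive.

Section Graphs.
Variables (T : finType) (e : rel T).

Definition simple_graph : Prop := symmetric e /\ irreflexive e.

Definition connected_graph : Prop := forall x y : T, connect e x y.

Definition deg (x : T) : nat := #|[set y | e x y]|.

Definition is_cycle (c : seq T) : Prop := [/\ uniq c, 3 <= size c & cycle e c].

(* c is the unique cycle of G: every cycle of G is the same cycle subgraph,
   i.e. a rotation of c or of its reversal. *)
Definition unique_cycle (c : seq T) : Prop :=
  is_cycle c /\
  forall c', is_cycle c' -> exists i, c' = rot i c \/ c' = rot i (rev c).

Definition shortest_path (s : seq T) : Prop :=
  match s with
  | [::] => False
  | x :: p => path e x p /\
      forall q, path e x q -> last x q = last x p -> size p <= size q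
  end.

Definition gp_set (S : {set T}) : Prop :=
  forall u v w, u \in S -> v \in S -> w \in S ->
    u != v -> v != w -> u != w ->
    ~ (exists s, [/\ shortest_path s, u \in s, v \in s & w \in s]).

Definition legal_move (S S' : {set T}) : Prop :=
  exists x y, [/\ x \in S, y \notin S, e x y, S' = y |: (S :\ x) & gp_set S'].

Definition mobile_gp_set (S : {set T}) : Prop :=
  gp_set S /\
  exists ss : seq {set T},
    (forall i, i < size ss -> legal_move (nth S (S :: ss) i) (nth S ss i)) /\
    (forall v : T, exists S', S' \in S :: ss /\ v \in S').

Definition is_mob (m : nat) : Prop :=
  (exists S, mobile_gp_set S /\ #|S| = m) /\
  (forall S, mobile_gp_set S -> #|S| <= m).

Definition k_cyc (c : seq T) : nat := #|[set x in c | 3 <= deg x]|.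

End Graphs.

(* Main.v *)
(* Write h = k/2 and l = 2L, and suppose m >= h + 3 robots are mobile.

   Trees: when a vertex v is visited, the other robots lie in one component of
   G - v.  Induction on the size of subtrees shows that every tree hanging at a
   cycle vertex contains at most one robot at all times, so robots have distinct
   projections to the cycle, and a robot off the cycle uses up one of the k
   cycle vertices of degree at least 3 (the roots).

   Cycle: when a robot is on the cycle, the projections of the others lie in a
   half circle of L vertices avoiding it, and at most one of these others is on
   the cycle.  Such a half circle therefore contains more than h roots, and by a
   discrete intermediate value argument it contains a vertex x with at most h
   roots in each of the two open half circles delimited by x and its antipode.
   The property "all robots but one project to a half circle containing x" is
   then invariant under moves, because losing it would force m - 2 > h robots
   off the cycle on one side of x; for the same reason it prevents x from being
   occupied.  Hence x is never visited.

   The bound is attained by the 4-cycle with leaves at two adjacent vertices. *)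
Require Import Defs.
From mathcomp Require Import all_boot.
From mathcomp Require Import zify.

Set Implicit Arguments.
Unset Strict Implicit.
Unset Printing Implicit Defensive.

(** * Shortest paths and separating vertices *)

Section Paths.
Variables (T : finType) (e : rel T).

Lemma shortest_path_exists x y : connect e x y ->
  exists p, [/\ path e x p, last x p = y &
    forall q, path e x q -> last x q = y -> size p <= size q].
Proof.
pose P n := [exists p : n.-tuple T, path e x p && (last x p == y)].
move=> /connectP[p0 p0P p0y].
have exP : exists n, P n.
  exists (size p0); apply/existsP; exists (in_tuple p0).
  by rewrite p0P -p0y eqxx.
case: (ex_minnP exP) => n /existsP[p /andP[pP /eqP py]] nmin.
exists p; split=> // q qP qy; rewrite size_tuple; apply: nmin.
by apply/existsP; exists (in_tuple q); rewrite qP qy eqxx.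
Qed.

(** Encodes that [v] separates [B] from its complement. Used for the branch at a cycle vertex and
    for components of the graph minus a vertex. *)
Definition gate (v : T) (B : {set T}) : Prop :=
  forall x y, x \in B -> x != v -> e x y -> y \in B.

Lemma path_leaves_gate v (B : {set T}) x p : gate v B ->
  path e x p -> x \in B -> last x p \notin B -> v \in x :: p.
Proof.
move=> gB; elim: p x => [|y p IH] x /=; first by move=> _ ->.
move=> /andP[exy yp] xB lB; rewrite inE; case: (eqVneq v x) => //= vx.
by apply: IH => //; apply: gB exy => //; rewrite eq_sym.
Qed.

Hypothesis e_sym : symmetric e.

Lemma path_enters_gate v (B : {set T}) x p : gate v B -> v \in B ->
  path e x p -> x \notin B -> last x p \in B -> v \in x :: p.
Proof.
move=> gB vB; elim: p x => [|y p IH] x /=; first by move=> _ /negbTE->.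
move=> /andP[exy yp] xB lB; rewrite inE; case: (eqVneq v x) => //= vx.
case: (boolP (y \in B)) => [yB|/IH]; last exact.
case: (eqVneq v y) => [->|vy]; first by rewrite mem_head.
by case/negP: xB; apply: gB (yB) _ _; rewrite 1?eq_sym // e_sym.
Qed.

Hypothesis e_conn : connected_graph e.

(** A shortest path from [u] to [w] exists by connectedness; as it cannot avoid [v], it carries all
    three robots. *)
Lemma gp_set_not_separated (S : {set T}) u v w :
  gp_set e S -> u \in S -> v \in S -> w \in S -> u != v -> v != w -> u != w ->
  ~ (forall p, path e u p -> last u p = w -> v \in u :: p).
Proof.
move=> gpS uS vS wS uv vw uw sep.
have [p [pP pw pmin]] := shortest_path_exists (e_conn u w).
apply: (gpS u v w) => //; exists (u :: p); split.
- by split=> // q qP; rewrite pw; apply: pmin.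
- exact: mem_head.
- exact: sep.
- by rewrite -pw mem_last.
Qed.

End Paths.

(* Unlike [legal_move], this relation is symmetric, so that invariants can be
   transported backwards as well as forwards in time. *)
Definition gp_move (T : finType) (e : rel T) (S S' : {set T}) : Prop :=
  [/\ gp_set e S, gp_set e S' &
   exists x y, [/\ x \in S, y \notin S, e x y & S' = y |: (S :\ x)]].

(** * Reversible moves and invariants of a run *)

Section Moves.
Variables (T : finType) (e : rel T).
Hypothesis e_sym : symmetric e.
Implicit Types S : {set T}.

Lemma gp_move_sym S S' : gp_move e S S' -> gp_move e S' S.
Proof.
case=> gS gS' [x [y [xS yS exy S'E]]]; split=> //.
have xy : x != y by apply: contraNneq yS => <-.
exists y, x; split; rewrite ?S'E 1?e_sym ?setU11 //.
  by rewrite !inE eqxx (negbTE xy).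
apply/setP=> z; rewrite !inE.
case: (eqVneq z x) => [->|zx] /=; first by rewrite xS.
by case: (eqVneq z y) => [->|zy] //=; rewrite (negbTE yS).
Qed.

Lemma gp_move_card S S' : gp_move e S S' -> #|S'| = #|S|.
Proof.
case=> _ _ [x [y [xS yS exy ->]]].
rewrite cardsU1 !inE (negbTE yS) andbF (cardsD1 x S) xS; lia.
Qed.

(** Moves being reversible, an invariant known at one state reaches earlier and later states alike.
    Preservation is asked only between states of the run, so facts known for those may be used. *)
Lemma mobile_invariant (P : {set T} -> Prop) S ss :
  gp_set e S ->
  (forall i, i < size ss -> legal_move e (nth S (S :: ss) i) (nth S ss i)) ->
  (forall S1 S2, S1 \in S :: ss -> S2 \in S :: ss ->
    gp_move e S1 S2 -> P S1 -> P S2) ->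
  forall S1 S2, S1 \in S :: ss -> S2 \in S :: ss -> P S1 -> P S2.
Proof.
move=> gS mv inv.
have gpi i : i <= size ss -> gp_set e (nth S (S :: ss) i).
  case: i => [_ //|i il]; have [x [y [_ _ _ _ gS']]] := mv i il.
  exact: gS'.
have step i : i < size ss ->
    gp_move e (nth S (S :: ss) i) (nth S (S :: ss) i.+1).
  move=> il; split; [exact/gpi/ltnW|exact: gpi|].
  by have [x [y [xS yS exy S'E _]]] := mv i il; exists x, y.
have to i : i <= size ss -> P S <-> P (nth S (S :: ss) i).
  elim: i => [|i IH] il; first by [].
  rewrite (IH (ltnW il)); split; apply: inv; rewrite ?mem_nth // ?ltnS 1?ltnW //;
    [exact: step | exact/gp_move_sym/step].
move=> S1 S2 /(nthP S)[i il <-] /(nthP S)[j jl <-].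
by rewrite -(to i) // -(to j).
Qed.

End Moves.

(** * The tree branches of a unicyclic graph *)

Section Unicyclic.
Variables (T : finType) (e : rel T) (c : seq T) (x0 : T).
Hypothesis e_sym : symmetric e.
Hypothesis e_conn : connected_graph e.
Hypothesis uc : unique_cycle e c.

Lemma unique_cycle_is_cycle : is_cycle e c. Proof. by case: uc. Qed.
Let c_uniq : uniq c. Proof. by case: unique_cycle_is_cycle. Qed.
Let c_size : 3 <= size c. Proof. by case: unique_cycle_is_cycle. Qed.
Let c_cycle : cycle e c. Proof. by case: unique_cycle_is_cycle. Qed.

Lemma unique_cycle_sub c' :
  is_cycle e c' -> {subset c' <= c} /\ size c' = size c.
Proof.
case: uc => _ /[apply] -[i [->|->]]; rewrite ?size_rot ?size_rev; split=> //.
  by move=> x; rewrite mem_rot.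
by move=> x; rewrite mem_rot mem_rev.
Qed.

(** Reading indices modulo the length lets arcs run past the end of [c]; [x0] is only the default of
    [nth]. *)
Definition cyc n := nth x0 c (n %% size c).

Lemma cyc_in n : cyc n \in c.
Proof. by rewrite mem_nth // ltn_mod; case: (c) c_size. Qed.

Lemma cyc_edge n : e (cyc n) (cyc n.+1).
Proof.
rewrite /cyc; case: c c_size c_cycle => [|a p] // _ /= /(pathP x0) H.
have nl : n %% (size p).+1 < (size p).+1 by rewrite ltn_mod.
have := H (n %% (size p).+1); rewrite size_rcons nl => /(_ isT).
rewrite -rcons_cons nth_rcons /= nl nth_rcons.
have -> : n.+1 %% (size p).+1 = (n %% (size p).+1).+1 %% (size p).+1.
  by rewrite -[n.+1]addn1 -modnDml addn1.
case: ltnP => np; first by rewrite (modn_small (m := _.+1)).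
have -> : n %% (size p).+1 = size p by lia.
by rewrite eqxx modnn.
Qed.

Definition arc n d := [seq cyc i | i <- iota n d].

Lemma path_arc n d : path e (cyc n) (arc n.+1 d).
Proof. by elim: d n => //= d IH n; rewrite cyc_edge IH. Qed.

Lemma last_arc n d : last (cyc n) (arc n.+1 d) = cyc (n + d).
Proof. by elim: d n => [|d IH] n /=; rewrite ?addn0 // IH addSnnS. Qed.

Lemma size_arc n d : size (arc n d) = d.
Proof. by rewrite size_map size_iota. Qed.

Lemma mem_arc n d t : t <= d -> cyc (n + t) \in cyc n :: arc n.+1 d.
Proof.
case: t => [|t] td; first by rewrite addn0 mem_head.
by rewrite inE map_f ?orbT // mem_iota; lia.
Qed.

Lemma cyc_small i : i < size c -> cyc i = nth x0 c i.
Proof. by move=> il; rewrite /cyc modn_small. Qed.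

Lemma cyc_index z : z \in c -> cyc (index z c) = z.
Proof. by move=> zc; rewrite cyc_small ?index_mem // nth_index. Qed.

Lemma index_cyc n : index (cyc n) c = n %% size c.
Proof. by rewrite index_uniq // ltn_mod; case: (c) c_size. Qed.

(** A nonempty ear [q], closed by an arc of [c] from [y] back to [z], would be a cycle with vertices
    off [c]. *)
Lemma no_ear z q y : z \in c -> y \in c -> z != y -> uniq q ->
  {in q, forall x, x \notin c} -> path e z (rcons q y) -> q = [::].
Proof.
move=> zc yc zy uq qc qP; case: (rot_to zc) => i c1 rotE.
have := c_uniq; rewrite -(rot_uniq i) rotE; have := c_cycle.
rewrite -(rot_cycle i) rotE.
have y1 : y \in c1.
  by move: yc; rewrite -(mem_rot i) rotE inE eq_sym (negbTE zy).
have in_c x : x \in z :: c1 -> x \in c by rewrite -rotE mem_rot.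
case/splitPr: c1 / y1 rotE in_c => p1 p2 rotE in_c cyc1 uniq1.
case: q uq qc qP => // a q uq qc qP; exfalso.
have [|sub _] := @unique_cycle_sub (z :: (a :: q) ++ y :: p2).
  split.
  - move: uniq1; rewrite cons_uniq mem_cat negb_or cat_uniq.
    move=> /andP[/andP[_ zp] /and3P[_ _ yp2]].
    rewrite cons_uniq mem_cat cat_uniq.
    rewrite negb_or zp uq yp2 !andbT; apply/andP; split.
      by apply: contraL zc; apply: qc.
    apply/hasPn => x xyp; apply/negP => /qc/negP; apply; apply: in_c.
    by rewrite inE mem_cat xyp !orbT.
  - by rewrite /= size_cat addnS.
  - move: cyc1 qP; rewrite rcons_path.
    rewrite -[cycle e _]/(path e z (rcons (p1 ++ y :: p2) z)).
    rewrite -[cycle e _]/(path e z (rcons ((a :: q) ++ y :: p2) z)).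
    rewrite !rcons_cat !cat_path /= => /and3P[_ _ yz] /andP[-> ->].
    exact: yz.
by have := sub a; rewrite !inE eqxx orbT => /(_ isT); apply/negP/qc/mem_head.
Qed.


(** Distance of positions around the cycle; the sum of truncated differences is the absolute
    difference. *)
Definition cdist i j := minn (i - j + (j - i)) (size c - (i - j + (j - i))).

(** If the indices differ by more than 1, the edge closes the arc between them into a cycle, which
    must have full length; so [z] and [y] are the two ends of the list [c]. *)
Lemma cycle_edge_cdist z y : z \in c -> y \in c -> e z y ->
  cdist (index z c) (index y c) <= 1.
Proof.
wlog: z y / index z c <= index y c => [W zc yc ezy|].
  case: (leqP (index z c) (index y c)) => [le|/ltnW le]; first exact: W.
  by have := W y z le yc zc; rewrite e_sym /cdist => /(_ ezy); lia.
move=> le zc yc ezy; rewrite /cdist.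
set i := index z c in le *; set j := index y c in le *.
have jl : j < size c by rewrite index_mem.
case: (leqP (j - i) 1) => ij; first by lia.
have [|_] := @unique_cycle_sub (arc i (j - i).+1); last by rewrite size_arc; lia.
split; first 1 last.
- by rewrite size_arc.
- rewrite /= rcons_path path_arc last_arc subnKC // !cyc_index //.
  by rewrite e_sym.
rewrite map_inj_in_uniq ?iota_uniq // => m n; rewrite !mem_iota => mi ni.
have ml : m < size c by lia.
have nl : n < size c by lia.
by rewrite !cyc_small // => /eqP; rewrite nth_uniq // => /eqP.
Qed.

(** * Trees hanging at the cycle and the projection to their roots *)

Definition tree_edge := [rel x y | e x y && ~~ ((x \in c) && (y \in c))].

Lemma tree_edge_sym : symmetric tree_edge.
Proof. by move=> x y /=; rewrite e_sym [(x \in c) && _]andbC. Qed.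

Lemma tree_connect_sym : connect_sym tree_edge.
Proof. exact: sym_connect_sym tree_edge_sym. Qed.

Lemma tree_connect_cycle v : exists2 z, z \in c & connect tree_edge v z.
Proof.
have /connectP[p pP pl] := e_conn v (nth v c 0).
have: last v p \in c by rewrite -pl mem_nth // (leq_trans _ c_size).
elim: p v pP {pl} => [|w p IH] v /=; first by exists v.
move=> /andP[evw /IH] /[apply] -[z zc wz].
case: (boolP (v \in c)) => vc; first by exists v.
by exists z => //; apply: connect_trans wz; rewrite connect1 //= evw (negbTE vc).
Qed.

(** Up to its first return to [c], a simple path of tree edges leaving [z] would be an ear, hence a
    single edge between cycle vertices, which is not a tree edge. *)
Lemma tree_connect_inj z y :
  z \in c -> y \in c -> connect tree_edge z y -> z = y.
Proof.
move=> zc yc /connectP[p0 /shortenP[p pP up _] {p0} yl].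
apply/eqP/negPn/negP => zy.
have hp : has (mem c) p.
  apply/hasP; exists y => //; rewrite yl; move: yl zy; case: (p) => [|a q] /=.
    by move=> ->; rewrite eqxx.
  by rewrite mem_last.
case: (split_find hp) pP up => {yl hp} a q r ac qc.
rewrite cat_path => /andP[zqa _] up.
have uqa : uniq (z :: rcons q a) by move: up; rewrite -cat_cons cat_uniq => /andP[].
have za : z != a.
  by apply: contraTneq uqa => ->; rewrite /= mem_rcons mem_head.
have q0 : q = [::].
  apply: (@no_ear z q a) => //.
  - by move: uqa; rewrite /= rcons_uniq => /and3P[].
  - by move=> x xq; apply: (hasPn qc).
  by apply: sub_path zqa => x w /andP[].
by move: zqa ac; rewrite q0 /= zc /= => /andP[/andP[_ /negbTE->]].
Qed.

(** The cycle vertex at which the tree of [v] hangs; the default [v] is never taken, by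
    [tree_connect_cycle]. *)
Definition proj v := odflt v [pick z in c | connect tree_edge v z].

Lemma projP v : proj v \in c /\ connect tree_edge v (proj v).
Proof.
rewrite /proj; case: pickP => [z /andP[]|no] //.
by have [z zc vz] := tree_connect_cycle v; have := no z; rewrite zc vz.
Qed.

Lemma proj_unique v z : z \in c -> connect tree_edge v z -> proj v = z.
Proof.
move=> zc vz; have [pc vp] := projP v.
by apply: tree_connect_inj => //; apply: connect_trans vz; rewrite tree_connect_sym.
Qed.

Lemma proj_id z : z \in c -> proj z = z.
Proof. by move=> zc; apply: proj_unique. Qed.

Lemma proj_edge x y : e x y -> proj x = proj y \/ (x \in c /\ y \in c).
Proof.
move=> exy; case: (boolP ((x \in c) && (y \in c))) => [/andP|xy]; first by right.
left; have [pc yp] := projP y; apply: proj_unique => //.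
by apply: connect_trans yp; rewrite connect1 //= exy.
Qed.

Definition cpos v := index (proj v) c.

Lemma cpos_lt v : cpos v < size c.
Proof. by rewrite index_mem; case: (projP v). Qed.

Lemma cpos_edge x y : e x y -> cdist (cpos x) (cpos y) <= 1.
Proof.
move=> exy; case: (proj_edge exy) => [pxy|[xc yc]].
  by rewrite /cpos pxy /cdist; lia.
by rewrite /cpos !proj_id //; apply: cycle_edge_cdist.
Qed.

(** Along each edge the projection moves by at most one position. *)
Lemma cdist_path x p : path e x p -> cdist (cpos x) (cpos (last x p)) <= size p.
Proof.
elim: p x => [|y p IH] x /=; first by rewrite /cdist; lia.
move=> /andP[/cpos_edge xy /IH]; move: xy.
move: (cpos_lt x) (cpos_lt y) (cpos_lt (last y p)); rewrite /cdist; lia.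
Qed.

Definition branch p := [set v | proj v == p].

Lemma branch_gate p : p \in c -> gate e p (branch p).
Proof.
move=> pc x y; rewrite !inE => /eqP xp xnp exy.
case: (proj_edge exy) => [<-|[xc _]]; first exact/eqP.
by move: xnp; rewrite -xp proj_id ?eqxx.
Qed.

(** An arc of at most half the cycle is a shortest route between its ends, so some shortest path
    from [u] to [w] follows the arc through [v]. *)
Lemma gp_set_cyclic (S : {set T}) u v w t d :
  gp_set e S -> u \in S -> v \in S -> w \in S -> v \in c ->
  0 < t < d -> d.*2 <= size c ->
  cpos v = (cpos u + t) %% size c -> cpos w = (cpos u + d) %% size c -> False.
Proof.
move=> gS uS vS wS vc td dl vt wd.
have [puc _] := projP u; have [pwc _] := projP w.
have ul := cpos_lt u.
have neq i j : i < j < size c -> (cpos u + i) %% size c <> (cpos u + j) %% size c.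
  move=> ij /eqP; rewrite eqn_modDl !modn_small; move: ij; clear; lia.
have uv : cpos u <> cpos v 
  by move: (neq 0 t); rewrite addn0 (modn_small ul) vt; apply; move: td dl; clear; lia.
have uw : cpos u <> cpos w 
  by move: (neq 0 d); rewrite addn0 (modn_small ul) wd; apply; move: td dl; clear; lia.
have vw : cpos v <> cpos w.
  by rewrite vt wd; apply: neq; move: td dl; clear; lia.
(* Any shortest path goes through [proj u] and then [proj w]; it is cut there into [pa], [pm] and
   [pb]. *)
have [p [pP pw pmin]] := shortest_path_exists (e_conn u w).
have mu : proj u \in u :: p.
  apply: (path_leaves_gate (branch_gate puc)) => //; rewrite !inE ?eqxx // pw.
  by apply/eqP => E; apply: uw; rewrite /cpos E.
case/splitPl: p / mu pP pw pmin => pa pr ua.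
rewrite cat_path last_cat ua => /andP[paP prP] prw pmin.
have mw : proj w \in proj u :: pr.
  apply: (path_enters_gate e_sym (branch_gate pwc)) => //; rewrite !inE ?prw ?eqxx //.
    by rewrite proj_id.
  by rewrite proj_id //; apply/eqP => E; apply: uw; rewrite /cpos E.
case/splitPl: pr / mw prP prw pmin => pm pb ub.
rewrite cat_path last_cat ub => /andP[pmP pbP] pbw pmin.
have dm : cdist (cpos u) (cpos w) <= size pm.
  by have := cdist_path pmP; rewrite ub /cpos (proj_id puc) (proj_id pwc).
have cu : cyc (cpos u) = proj u by rewrite cyc_index.
have cw : cyc (cpos u + d) = proj w.
  by rewrite -[RHS](cyc_index pwc) -/(cpos w) wd /cyc modn_mod.
have cv : cyc (cpos u + t) = v.
  by rewrite -[RHS](cyc_index vc) -[X in index X c]proj_id // -/(cpos v) vt /cyc modn_mod.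
(* Here [d] being at most half the cycle matters: the other way round is no shorter. *)
have dd : d <= size pm.
  apply: leq_trans dm; rewrite /cdist wd; move: ul dl; clear=> ul dl.
  case: (ltnP (cpos u + d) (size c)) => udl; first by rewrite modn_small //; lia.
  have -> : cpos u + d = cpos u + d - size c + size c by lia.
  rewrite modnDr modn_small; lia.
apply: (gS u v w) => //; try by apply/eqP => E; move: uv uw vw; rewrite E.
(* Replacing [pm] by the arc does not lengthen the path and makes it visit [v]. *)
exists (u :: pa ++ arc (cpos u).+1 d ++ pb); split.
- split.
    rewrite !cat_path paP ua -cu path_arc last_arc cw pbP //.
  move=> q qP; rewrite !last_cat ua -cu last_arc cw pbw => qw.
  apply: leq_trans (pmin q qP qw).
  by rewrite !size_cat size_arc leq_add2l leq_add2r.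
- exact: mem_head.
- have: v \in cyc (cpos u) :: arc (cpos u).+1 d.
    by rewrite -cv; apply: mem_arc; move: td; clear; lia.
  rewrite cu -ua inE => /orP[/eqP->|vA]; last by rewrite inE !mem_cat vA !orbT.
  by rewrite -cat_cons mem_cat mem_last.
- by have := mem_last u (pa ++ arc (cpos u).+1 d ++ pb); rewrite !last_cat ua -cu last_arc cw pbw.
Qed.

(** Besides its two cycle neighbours, [proj u] has a neighbour off the cycle on the way to [u]. *)
Lemma tree_vertex_root u : u \notin c -> 3 <= deg e (proj u).
Proof.
move=> uc'; have [pc up] := projP u.
rewrite tree_connect_sym in up; case/connectP: up => -[|a p] /=.
  by move=> _ E; move: uc'; rewrite E pc.
move=> /andP[/andP[ea]]; rewrite pc /= => ac _ _.
set z := proj u in pc ea *; set i := index z c.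
have il : i < size c by rewrite index_mem.
have e1 : e z (cyc i.+1) by rewrite -{1}(cyc_index pc) cyc_edge.
(* Adding [(size c).-1] steps back by one modulo the length. *)
have e2 : e z (cyc (i + (size c).-1)).
  have zE : z = cyc (i + (size c).-1).+1.
    rewrite -{1}(cyc_index pc) -/i /cyc -addnS prednK ?modnDr //; lia.
  by rewrite e_sym {1}zE cyc_edge.
have n12 : cyc i.+1 != cyc (i + (size c).-1).
  apply/eqP => /(congr1 (index^~ c)) /eqP.
  by rewrite !index_cyc -addn1 eqn_modDl !modn_small; move: c_size; clear; lia.
apply: leq_trans (_ : #|[set a; cyc i.+1; cyc (i + (size c).-1)]| <= _).
  rewrite -setUA cardsU1 cards2 n12 !inE negb_or.
  by rewrite !(contraNneq _ ac) // => ->; apply: cyc_in.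
apply: subset_leq_card; apply/subsetP => x; rewrite !inE -orbA.
by move=> /or3P[] /eqP->.
Qed.

End Unicyclic.

(** * One robot per branch *)

Lemma card_lt_mem (T : finType) (A B : {set T}) :
  #|B| < #|A| -> exists2 z, z \in A & z \notin B.
Proof.
move=> lt; apply/subsetPn; apply: contraL lt => /subset_leq_card.
by rewrite -leqNgt.
Qed.

Section OneRobotPerBranch.
Variables (T : finType) (e : rel T) (c : seq T).
Hypothesis e_sym : symmetric e.
Hypothesis e_conn : connected_graph e.
Hypothesis uc : unique_cycle e c.

Definition at_most_one (S B : {set T}) : Prop :=
  forall a b, a \in S -> b \in S -> a \in B -> b \in B -> a = b.

(** A second robot could enter [B] only at [v], where it would separate the robot already in [B]
    from a third one outside. *)
Lemma at_most_one_move (B : {set T}) v S1 S2 : gate e v B ->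
  gp_move e S1 S2 -> 3 <= #|S1| -> at_most_one S1 B -> at_most_one S2 B.
Proof.
move=> gB [_ gS2 [x [y [xS1 yS1 exy S2E]]]] card3 one1.
have newcomer b : y \in B -> b \in B -> b \in S1 -> b != x -> False.
  move=> yB bB bS1 bx.
  case: (boolP (x \in B)) => xB; first by rewrite (one1 b x) ?eqxx in bx.
  have yv : y = v.
    by apply: contraNeq xB => yv; apply: gB yB yv _; rewrite e_sym.
  have [d dS1] : exists2 d, d \in S1 & d \notin [set x; b].
    by apply: card_lt_mem; rewrite cards2; move: card3; clear; lia.
  rewrite !inE negb_or => /andP[dx db].
  have dB : d \notin B by apply: contraNN db => dB; apply/eqP/one1.
  have by' : b != y by apply: contraTneq bS1 => ->.
  have dy : y != d by apply: contraTneq dS1 => <-.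
  apply: (gp_set_not_separated e_conn gS2 (u := b) (v := y) (w := d)) => //.
  - by rewrite S2E !inE bx bS1 orbT.
  - by rewrite S2E !inE eqxx.
  - by rewrite S2E !inE dx dS1 orbT.
  - by rewrite eq_sym.
  - move=> p pP pd; rewrite yv; apply: (path_leaves_gate gB pP bB).
    by rewrite pd.
move=> a b; rewrite S2E !inE.
move=> /orP[/eqP->|/andP[ax aS]] /orP[/eqP->|/andP[bx bS]] // aB bB.
- by case: (newcomer b).
- by case: (newcomer a).
- exact: one1.
Qed.

Variables (S : {set T}) (ss : seq {set T}).
Hypothesis gpS : gp_set e S.
Hypothesis moves :
  forall i, i < size ss -> legal_move e (nth S (S :: ss) i) (nth S ss i).
Hypothesis visits : forall v : T, exists S', S' \in S :: ss /\ v \in S'.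
Hypothesis card3 : 3 <= #|S|.

Lemma states_card S' : S' \in S :: ss -> #|S'| = #|S|.
Proof.
move=> S'in; apply: (mobile_invariant e_sym (P := fun S' => #|S'| = #|S|)
  gpS moves _ (mem_head S ss) S'in) => // S1 S2 _ _.
by move=> /gp_move_card->.
Qed.

Lemma states_gp S' : S' \in S :: ss -> gp_set e S'.
Proof.
move=> S'in; apply: (mobile_invariant e_sym (P := gp_set e)
  gpS moves _ (mem_head S ss) S'in) => // S1 S2 _ _.
by case.
Qed.

(* When v is visited, all other robots lie in one component of G - v.  If that
   component were inside B it would be a smaller gated set, holding at least
   two robots. *)
Lemma gated_at_most_one (B : {set T}) v : v \in B -> gate e v B ->
  {in B, forall z, z \in c -> z = v} ->
  forall S', S' \in S :: ss -> at_most_one S' B.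
Proof.
have [n] := ubnP #|B|; elim: n => // n IH in B v *.
move=> Bn vB gB Bc S' S'in.
have [S1 [S1in vS1]] := visits v.
have gS1 := states_gp S1in; have cS1 := states_card S1in.
(* It suffices to treat the state in which [v] is occupied; the invariant carries the claim to all
   others. *)
suff one1 : at_most_one S1 B.
  have [] // := mobile_invariant e_sym
    (P := fun S' => #|S'| = #|S| /\ at_most_one S' B)
    gpS moves _ S1in S'in.
  move=> S2 S3 _ _ mv [cS2 one2]; rewrite (gp_move_card mv) cS2; split=> //.
  by apply: (at_most_one_move gB mv) one2; rewrite cS2.
suff only_v a : a \in S1 -> a \in B -> a = v.
  by move=> a b aS bS aB bB; rewrite (only_v a) // (only_v b).
move=> aS aB; apply/eqP/negPn/negP => av; exfalso.
(* [ev] is the graph without [v], and [C] the component of [a] in it. *)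
pose ev := [rel x y | [&& e x y, x != v & y != v]].
have ev_sym : connect_sym ev.
  by apply: sym_connect_sym => x y /=; rewrite e_sym [(x != v) && _]andbC.
pose C := [set z | connect ev a z].
have aC : a \in C by rewrite inE connect0.
have CP z : z \in C -> z \in B /\ z != v.
  rewrite inE => /connectP[p pP ->]; elim: p a aB av {aS aC C} pP => //= y p IHp.
  move=> x xB xv /andP[/and3P[exy _ yv] yp]; apply: IHp => //.
  exact: gB exy.
have Cstep x y : x \in C -> e x y -> y != v -> y \in C.
  move=> xC exy yv; have [_ xv] := CP x xC; move: xC; rewrite !inE => xC.
  by apply: connect_trans xC _; rewrite connect1 //= exy xv.
have gvC : gate e v (v |: C).
  move=> x y; rewrite in_setU1 => /orP[->//|xC] _ exy; rewrite in_setU1.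
  by case: eqVneq => //= yv; apply: Cstep exy yv.
(* Otherwise the robot on [v] would separate [a] from [b]. *)
have inC b : b \in S1 -> b != v -> b \in C.
  move=> bS bv; apply/negPn/negP => bC.
  apply: (gp_set_not_separated e_conn gS1 (u := a) (v := v) (w := b)) => //.
  - by rewrite eq_sym.
  - by apply: contraNneq bC => <-.
  move=> p pP pb; apply: (path_leaves_gate gvC pP); rewrite in_setU1 ?aC ?orbT //.
  by rewrite pb negb_or bv.
have [w wC ewv] : exists2 w, w \in C & e w v.
  have /connectP[p pP pv] := e_conn a v.
  elim: p (a) aC pP pv => [|y p IHp] x xC /=.
    by move=> _ vx; have [_] := CP x xC; rewrite vx eqxx.
  move=> /andP[exy yp] pv; case: (eqVneq y v) => [yv|yv].
    by exists x; rewrite // -yv.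
  exact: (IHp y (Cstep x y xC exy yv)).
have [wB wv] := CP w wC.
(* Two neighbours of [v] in [C] would give a cycle through [v] and [w], although [v] is the only
   possible cycle vertex of [B]. Hence [w] is a gate of [C]. *)
have w_unique x : x \in C -> e x v -> x = w.
  move=> xC exv; apply/eqP/negPn/negP => xw.
  have : connect ev w x.
    by move: wC xC; rewrite !inE ev_sym => aw ax; apply: connect_trans aw ax.
  case/connectP => p0 /shortenP[p pP up _] xl.
  have vp : v \notin w :: p.
    rewrite inE negb_or eq_sym wv /=; apply/negP => vp.
    elim: p (w) pP vp {up xl} => //= y p IHp z /andP[/and3P[_ _ yv] yp].
    by rewrite inE eq_sym (negbTE yv) /=; apply: IHp yp.
  have [|sub _] := unique_cycle_sub uc (c' := v :: w :: p).
    split; first by rewrite cons_uniq vp.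
    - case: (p) xl => [|//] xl; by rewrite xl eqxx in xw.
    - rewrite /= rcons_path -xl exv e_sym ewv andbT.
      by apply: sub_path pP => ? ? /andP[].
  have wc : w \in c by apply: sub; rewrite !inE eqxx orbT.
  by rewrite (Bc w wB wc) eqxx in wv.
have CB : #|C| < #|B|.
  apply: proper_card; apply/properP; split.
    by apply/subsetP => z /CP[].
  by exists v => //; apply/negP => /CP[_]; rewrite eqxx.
have [b bS] : exists2 b, b \in S1 & b \notin [set a; v].
  by apply: card_lt_mem; rewrite cards2 cS1; move: card3; clear; lia.
rewrite !inE negb_or => /andP[ba bv]; case/negP: ba; apply/eqP.
have oneC : at_most_one S1 C; last exact: (oneC b a bS aS (inC b bS bv) aC).
apply: (IH C w) => //.
- by apply: leq_trans CB _; rewrite -ltnS.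
- move=> x y xC xw exy; apply: (Cstep x) => //; apply: contraNneq xw => yv.
  by rewrite (w_unique x) // -yv.
- move=> z zC zc; have [zB zv] := CP z zC.
  by rewrite (Bc z zB zc) eqxx in zv.
Qed.

Lemma states_proj_inj S' :
  S' \in S :: ss -> {in S' &, injective (proj e c)}.
Proof.
move=> S'in a b aS bS ab; have [pc _] := projP e_conn uc a.
apply: (gated_at_most_one _ (branch_gate e_sym e_conn uc pc) _ S'in) => //.
- by rewrite inE (proj_id e_sym e_conn uc).
- by move=> z; rewrite inE => /eqP<- /(proj_id e_sym e_conn uc)->.
- by rewrite inE.
- by rewrite inE ab.
Qed.

End OneRobotPerBranch.

(** * Robots around an even circle *)

Section Circle.
Variables (T : finType) (C : {set T}) (L h : nat).
Implicit Types (p : T -> nat) (S : {set T}).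

(* The robots S project to distinct points p u of the circle Z/2L, and no
   robot of C (the robots on the circle itself) lies on a shortest arc between
   the projections of two others. *)
Definition spread p S : Prop :=
  [/\ forall u, p u < L.*2, {in S &, injective p} &
      forall u v w, u \in S -> v \in S -> w \in S -> v \in C ->
      (p u < p v < p w -> p u + L < p w) /\
      (p u < p w -> (p v < p u) || (p w < p v) -> p w < p u + L)].

(** Only robots off the circle count, as these use up roots. The conditions describe the two open
    half circles between 0 and its antipode [L]. *)
Definition balanced p S : Prop :=
  #|[set u in S | (u \notin C) && (0 < p u < L)]| <= h /\
  #|[set u in S | (u \notin C) && (L < p u)]| <= h.

(* The set of positions at most s or above s + L is a half circle of L
   consecutive points containing 0. *)
Definition in_half p S y s : Prop :=
  s < L /\ forall u, u \in S -> u != y -> p u <= s \/ s + L < p u.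

Definition almost_in_half p S : Prop :=
  exists w s, w \in S /\ in_half p S w s.

(** Negation modulo 2L, with 0 kept in range; it exchanges the two half circles and halves the case
    analysis. *)
Definition reflect_pos p u := if p u == 0 then 0 else L.*2 - p u.

Lemma spread_reflect p S : spread p S -> spread (reflect_pos p) S.
Proof.
case=> pl pinj pG; split.
- by move=> u; have := pl u; rewrite /reflect_pos; case: eqP; lia.
- move=> u v uS vS; rewrite /reflect_pos; have := pl u; have := pl v.
  by do 2 case: eqP; move=> *; apply: pinj => //; lia.
move=> u v w uS vS wS vC.
have [A1 A2] := pG u v w uS vS wS vC; have [B1 B2] := pG w v u wS vS uS vC.
move: A1 A2 B1 B2 (pl u) (pl v) (pl w); rewrite /reflect_pos; clear.
case: (p u =P 0); case: (p v =P 0); case: (p w =P 0); lia.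
Qed.

Lemma balanced_reflect p S : (forall u, p u < L.*2) ->
  balanced p S -> balanced (reflect_pos p) S.
Proof.
move=> pl [bR bL]; split.
  apply: leq_trans bL; apply: subset_leq_card; apply/subsetP => u; rewrite !inE.
  by have := pl u; rewrite /reflect_pos; case: eqP => //; lia.
apply: leq_trans bR; apply: subset_leq_card; apply/subsetP => u; rewrite !inE.
by have := pl u; rewrite /reflect_pos; case: eqP => //; lia.
Qed.

Lemma in_half_reflect p S y s : (forall u, p u < L.*2) ->
  in_half p S y s -> in_half (reflect_pos p) S y (L - s.+1).
Proof.
move=> pl [sL H]; split; first by lia.
move=> u uS uy; have := H u uS uy; have := pl u.
by rewrite /reflect_pos; case: eqP; lia.
Qed.

Lemma reflect_posK p u : p u < L.*2 -> reflect_pos (reflect_pos p) u = p u.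
Proof. by rewrite /reflect_pos; case: (p u =P 0) => //; case: eqP; lia. Qed.

Lemma in_half_unreflect p S y s : (forall u, p u < L.*2) ->
  in_half (reflect_pos p) S y s -> exists s', in_half p S y s'.
Proof.
move=> pl H; exists (L - s.+1).
have [|sL H'] := in_half_reflect _ H.
  by move=> u; have := pl u; rewrite /reflect_pos; case: eqP; lia.
by split=> // u uS uy; rewrite -[p u]reflect_posK //; apply: H'.
Qed.

(** * Balanced configurations, up to reflection *)

Section OrientedConfiguration.
Variables (p : T -> nat) (S : {set T}).
Hypothesis spS : spread p S.
Hypothesis balS : balanced p S.
Hypothesis h_gt0 : 0 < h.
Hypothesis cardS : h + 3 <= #|S|.

Let pl u : p u < L.*2. Proof. by case: spS. Qed.
Let pinj : {in S &, injective p}. Proof. by case: spS. Qed.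
Let pG u v w : u \in S -> v \in S -> w \in S -> v \in C ->
  (p u < p v < p w -> p u + L < p w) /\
  (p u < p w -> (p v < p u) || (p w < p v) -> p w < p u + L).
Proof. by case: spS => _ _; apply. Qed.

(** Among [h + 3] robots, discarding two and at most [h] more leaves one. *)
Lemma two_missing (P : pred T) y z :
  #|[set u in S | P u]| <= h ->
  exists u, [/\ u \in S, u != y, u != z & ~~ P u].
Proof.
move=> le; have [u uS] : exists2 u, u \in S & u \notin [set y; z] :|: [set u in S | P u].
  apply: card_lt_mem; apply: leq_ltn_trans (leq_card_setU _ _) _.
  by rewrite cards2; lia.
rewrite !inE uS /= !negb_or -andbA => /and3P[uy uz Pu].
by exists u.
Qed.

Lemma fourth_robot y z w : exists u, [/\ u \in S, u != y, u != z & u != w].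
Proof.
have [|u []] := @two_missing (pred1 w) y z; last by exists u.
apply: leq_trans h_gt0; rewrite -(cards1 w) subset_leq_card //.
by apply/subsetP => u; rewrite !inE => /andP[].
Qed.

Lemma robot_out_right y z :
  exists u, [/\ u \in S, u != y, u != z & (u \in C) || ~~ (0 < p u < L)].
Proof.
have [u [uS uy uz H]] := two_missing y z balS.1; exists u; split=> //.
by rewrite -[u \in C]negbK -negb_and.
Qed.

Lemma robot_out_left y z :
  exists u, [/\ u \in S, u != y, u != z & (u \in C) || (p u <= L)].
Proof.
have [u [uS uy uz H]] := two_missing y z balS.2; exists u; split=> //.
by rewrite -[u \in C]negbK leqNgt -negb_and.
Qed.

(** The exceptional robot [w] can be exchanged for any robot [y] on the circle, possibly after
    rotating the half circle. *)
Lemma on_circle_in_half_right w s y :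
  in_half p S w s -> w \in S -> y \in S -> y \in C -> y != w -> p y <= s ->
  exists s', in_half p S y s'.
Proof.
move=> [sL H] wS yS yC yw ys.
have ne u v : u \in S -> v \in S -> u != v -> p u <> p v.
  by move=> uS vS uv /pinj E; rewrite E ?eqxx in uv.
have ywp := ne y w yS wS yw.
case: (boolP ((p w <= s) || (s + L < p w))) => [/orP wA|wA].
  by exists s; split=> // u uS uy; case: (eqVneq u w) => [->|/(H u uS)].
(* If some [u] lies between [y] and the end [s], no robot other than [w] can precede [y]. Balance
   then puts a [z] among them on the circle, and [z] conflicts with a fourth robot [t] together with
   [y] or [w]. *)
case: (boolP [exists u in S, [&& u != y, u != w & p y < p u <= s]]).
  case/existsP => u /and4P[uS uy uw ups]; exfalso.
  have after t : t \in S -> t != y -> t != w -> p y < p t <= s.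
    move=> tS ty tw; case: (eqVneq t u) => [->//|tu].
    have := H t tS tw; have := ne t y tS yS ty.
    have := pG tS yS uS yC; have := pG uS yS tS yC.
    by move: sL ys ups; clear; lia.
  have [z [zS zy zw]] := robot_out_right y w.
  have zp := after z zS zy zw; case: (boolP (z \in C)) => [zC _|_]; last first.
    by move: zp sL; clear; lia.
  have [t [tS ty tw tz]] := fourth_robot y w z.
  have tp := after t tS ty tw; have := ne t z tS zS tz.
  have := (pG yS zS tS zC).1; have := (pG tS zS wS zC).1.
  have := (pG tS yS wS yC).2.
  by move: zp tp ys sL wA; clear; lia.
rewrite negb_exists => /forallP none.
have before u : u \in S -> u != y -> u != w -> p u < p y \/ s + L < p u.
  move=> uS uy uw; have := none u; rewrite uS uy uw /=.
  have := H u uS uw; have := ne u y uS yS uy; clear; lia.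
(* For [w] beyond the antipode, the half circle starting at [w] works. *)
case: (ltnP L (p w)) => wL.
  exists (p w - L.+1); split; first by have := pl w; move: wL; clear; lia.
  move=> u uS uy; case: (eqVneq u w) => [->|uw]; first by move: wL; clear; lia.
  have := before u uS uy uw; have := (pG uS yS wS yC).1.
  by move: wL wA ys ywp; clear; lia.
(* Otherwise all robots but [y] and [w] lie strictly left of the origin, and balance gives the
   mirrored contradiction. *)
exfalso.
have left u : u \in S -> u != y -> u != w -> s + L < p u.
  move=> uS uy uw; have := before u uS uy uw; have := (pG uS yS wS yC).1.
  by move: wL wA ys ywp; clear; lia.
have [z [zS zy zw]] := robot_out_left y w.
have zp := left z zS zy zw; case: (boolP (z \in C)) => [zC _|_]; last first.
  by move: zp; clear; lia.
have [t [tS ty tw tz]] := fourth_robot y w z.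
have tp := left t tS ty tw; have := ne t z tS zS tz.
have := (pG yS zS tS zC).2; have := (pG wS zS tS zC).1.
have := (pG wS yS tS yC).2.
by move: zp tp ys sL wA; clear; lia.
Qed.

(** With [y] at the origin and [u] on its right, every other robot is on the right too. Balance
    forces two of them onto the circle, and the nearer lies between [y] and the farther. *)
Lemma origin_free_right y s u :
  in_half p S y s -> y \in S -> y \in C -> p y = 0 ->
  u \in S -> u != y -> p u <= s -> False.
Proof.
move=> [sL H] yS yC y0 uS uy us.
have pos t : t \in S -> t != y -> 0 < p t.
  move=> tS ty; rewrite lt0n; apply: contra ty => /eqP t0.
  by apply/eqP/pinj => //; rewrite y0.
have right t : t \in S -> t != y -> 0 < p t < L.
  move=> tS ty; have := H t tS ty; have := (pG uS yS tS yC).2.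
  by have := pos t tS ty; have := pos u uS uy; move: us sL; rewrite y0; clear; lia.
have [z [zS zy _]] := robot_out_right y y.
rewrite right // orbF => zC.
have [t [tS ty tz]] := robot_out_right y z.
rewrite right // orbF => tC.
have zt : p z <> p t by move=> /pinj E; rewrite E ?eqxx in tz.
have := (pG yS zS tS zC).1; have := (pG yS tS zS tC).1.
have := right z zS zy; have := right t tS ty.
by move: y0 zt; clear; lia.
Qed.

End OrientedConfiguration.

Section Configuration.
Variables (p : T -> nat) (S : {set T}).
Hypothesis spS : spread p S.
Hypothesis balS : balanced p S.
Hypothesis h_gt0 : 0 < h.
Hypothesis cardS : h + 3 <= #|S|.

Let pl u : p u < L.*2. Proof. by case: spS. Qed.

Lemma on_circle_in_half y :
  almost_in_half p S -> y \in S -> y \in C -> exists s, in_half p S y s.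
Proof.
move=> [w [s [wS Hs]]] yS yC.
case: (eqVneq y w) => [->|yw]; first by exists s.
have [sL H] := Hs; case: (H y yS yw) => ys.
  exact: (on_circle_in_half_right spS balS h_gt0 cardS Hs).
have [|s' Hs'] := on_circle_in_half_right (spread_reflect spS)
  (balanced_reflect pl balS) h_gt0 cardS (in_half_reflect pl Hs) wS yS yC yw.
  by have := pl y; rewrite /reflect_pos; case: eqP; lia.
exact: in_half_unreflect Hs'.
Qed.

Lemma origin_free y :
  almost_in_half p S -> y \in S -> y \in C -> p y <> 0.
Proof.
move=> KS yS yC y0; have [s Hs] := on_circle_in_half KS yS yC.
have [u [uS uy _ _]] := fourth_robot h_gt0 cardS y y y.
have [sL H] := Hs; case: (H u uS uy) => us.
  exact: (origin_free_right spS balS h_gt0 cardS Hs yS yC y0 uS uy us).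
apply: (origin_free_right (spread_reflect spS) (balanced_reflect pl balS) h_gt0 cardS
  (in_half_reflect pl Hs) yS yC _ uS uy); rewrite /reflect_pos ?y0 //.
by have := pl u; case: eqP => //; move: us sL; clear; lia.
Qed.

(** The window starts at the first robot [m] after [y]: a robot at distance [L] or more from [m]
    would put [y] on a shortest arc. The minimum with [L] keeps the window clear of [y]. *)
Lemma others_in_window y : y \in S -> y \in C -> p y = 0 ->
  exists a, 0 < a <= L /\ forall u, u \in S -> u != y -> a <= p u < a + L.
Proof.
move=> yS yC y0; have [_ pinj pG] := spS.
have [u0 [u0S u0y _ _]] := fourth_robot h_gt0 cardS y y y.
have u0D : u0 \in S :\ y by rewrite !inE u0y.
case: (@arg_minnP _ u0 [in S :\ y] p u0D) => m; rewrite !inE => /andP[my mS] mmin.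
have pos t : t \in S -> t != y -> 0 < p t.
  move=> tS ty; rewrite lt0n; apply: contra ty => /eqP t0.
  by apply/eqP/pinj => //; rewrite y0.
have L0 : 0 < L by have := pl y; clear; lia.
exists (minn (p m) L); have m0 := pos m mS my; split; first by move: m0 L0; clear; lia.
move=> u uS uy; have := mmin u; rewrite !inE uy uS => /(_ isT).
have := (pG m y u mS yS uS yC).2; have := pl u.
by move: m0 L0; rewrite y0; clear; lia.
Qed.

(** If [z] and [u] were both on the circle, a fourth robot [t] before, between or after them would
    violate the spread condition. *)
Lemma others_off_circle y : y \in S -> y \in C -> p y = 0 ->
  exists z, forall u, u \in S -> u != y -> u != z -> u \notin C.
Proof.
move=> yS yC y0; have [_ pinj pG] := spS.
have [a [aL win]] := others_in_window yS yC y0.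
have ne v w : v \in S -> w \in S -> v != w -> p v <> p w.
  by move=> vS wS vw /pinj E; rewrite E ?eqxx in vw.
have two z u : z \in S -> u \in S -> z != y -> u != y -> z \in C -> u \in C ->
    p z < p u -> False.
  move=> zS uS zy uy zC uC zu.
  have [t [tS ty tz tu]] := fourth_robot h_gt0 cardS y z u.
  have := win z zS zy; have := win u uS uy; have := win t tS ty.
  have := ne t z tS zS tz; have := ne t u tS uS tu.
  have := (pG y z t yS zS tS zC).1; have := (pG y u t yS uS tS uC).2.
  have := (pG t z u tS zS uS zC).1; have := (pG z u t zS uS tS uC).1.
  by move: y0 aL zu; clear => ->; lia.
case: (boolP [exists z in S, (z != y) && (z \in C)]); last first.
  rewrite negb_exists => /forallP none; exists y => u uS uy _.
  by have := none u; rewrite uS uy.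
case/existsP => z /and3P[zS zy zC]; exists z => u uS uy uz; apply/negP => uC.
case: (ltngtP (p z) (p u)) => [/two|/two|/esym /(ne _ _ uS zS uz)] //; exact.
Qed.

End Configuration.
End Circle.

(** * Choosing a balanced origin *)

Section Rotation.
Variables (T : finType) (C : {set T}) (L h : nat).
Implicit Types (p q : T -> nat) (S R : {set T}).

(** The position [i] as seen from the origin [b], that is [i - b] modulo 2L. *)
Definition off b i := if b <= i then i - b else i + L.*2 - b.

Lemma off_lt b i : b < L.*2 -> i < L.*2 -> off b i < L.*2.
Proof. by rewrite /off; case: (leqP b i); lia. Qed.

Lemma off_off b b' : b < L.*2 -> b' < L.*2 ->
  exists2 d, d < L.*2 & forall i, i < L.*2 -> off b' (off b i) = off d i.
Proof.
move=> bl bl'; case: (ltnP (b + b') L.*2) => bb; [exists (b + b')|exists (b + b' - L.*2)];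
  rewrite // /off; try lia; move=> i il.
  by case: (leqP b i) => bi; case: leqP => ?; case: leqP => ?; lia.
by case: (leqP b i) => bi; case: leqP => ?; case: leqP => ?; lia.
Qed.

Lemma spread_off b p S : b < L.*2 ->
  spread C L p S -> spread C L (fun u => off b (p u)) S.
Proof.
move=> bl [pl pinj pG]; split.
- by move=> u; apply: off_lt.
- move=> u v uS vS E; apply: pinj => //; move: E (pl u) (pl v).
  by rewrite /off; case: (leqP b (p u)); case: (leqP b (p v)); lia.
move=> u v w uS vS wS vC.
have [A1 A2] := pG u v w uS vS wS vC; have [B1 B2] := pG w v u wS vS uS vC.
move: A1 A2 B1 B2 (pl u) (pl v) (pl w) bl; rewrite /off; clear.
by case: (leqP b (p u)); case: (leqP b (p v)); case: (leqP b (p w)); lia.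
Qed.

Lemma leq_card_disjoint R (P Q : pred T) :
  (forall r, r \in R -> P r -> ~~ Q r) ->
  #|[set r in R | P r]| + #|[set r in R | Q r]| <= #|R|.
Proof.
move=> PQ; rewrite -(cardsID [set r | P r] R); apply: leq_add.
  by apply/subset_leq_card/subsetP => r; rewrite !inE.
apply/subset_leq_card/subsetP => r; rewrite !inE => /andP[rR Qr].
by rewrite rR andbT; apply: contraL Qr; apply: PQ.
Qed.

(* Moving a + j through the half circle, the first j for which at most half of
   R lies right of a + j also has at most half of R on its left. *)
Lemma balanced_point q R a : (forall r, q r < L.*2) -> 0 < a <= L ->
  #|R| <= h.*2 -> h < #|[set r in R | a <= q r < a + L]| ->
  exists2 j, j < L &
    #|[set r in R | 0 < off (a + j) (q r) < L]| <= h /\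
    #|[set r in R | L < off (a + j) (q r)]| <= h.
Proof.
move=> ql aL Rh win.
pose P j := #|[set r in R | 0 < off (a + j) (q r) < L]| <= h.
(* The right half circle of the last point of the window misses the window, which holds more than
   [h] elements of [R]. *)
have PL : P L.-1.
  have := @leq_card_disjoint R (fun r => 0 < off (a + L.-1) (q r) < L)
    (fun r => a <= q r < a + L).
  rewrite /P => /(_ _) le; suff: #|[set r in R | 0 < off (a + L.-1) (q r) < L]| +
    #|[set r in R | a <= q r < a + L]| <= #|R| by move: win Rh; clear; lia.
  apply: le => r _; have := ql r; move: aL; rewrite /off; clear.
  by case: (leqP (a + L.-1) (q r)); lia.
have exP : exists j, P j by exists L.-1.
case: (ex_minnP exP) => j Pj jmin; have jL := jmin _ PL.
exists j; first by move: jL aL; clear; lia.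
split=> //; case: j Pj jmin jL => [|j] Pj jmin jL.
  have := @leq_card_disjoint R (fun r => a <= q r < a + L)
    (fun r => L < off (a + 0) (q r)).
  move=> /(_ _) le; suff: #|[set r in R | a <= q r < a + L]| +
    #|[set r in R | L < off (a + 0) (q r)]| <= #|R| by move: win Rh; clear; lia.
  apply: le => r _; have := ql r; move: aL; rewrite /off; clear.
  by case: (leqP (a + 0) (q r)); lia.
(* By minimality more than [h] elements lie right of the previous point, and that half circle is
   disjoint from the left one of the present point. *)
have : ~~ P j by apply/negP => /jmin; rewrite ltnn.
rewrite /P -ltnNge => Fj.
have := @leq_card_disjoint R (fun r => 0 < off (a + j) (q r) < L)
    (fun r => L < off (a + j.+1) (q r)).
move=> /(_ _) le; suff: #|[set r in R | 0 < off (a + j) (q r) < L]| +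
    #|[set r in R | L < off (a + j.+1) (q r)]| <= #|R| by move: Fj Rh; clear; lia.
apply: le => r _; have := ql r; move: aL jL; rewrite /off; clear.
by case: (leqP (a + j) (q r)); case: (leqP (a + j.+1) (q r)); lia.
Qed.

Hypothesis h_gt0 : 0 < h.

Lemma balanced_half_exists p S R y :
  spread C L p S -> h + 3 <= #|S| -> #|R| <= h.*2 ->
  (forall Q : pred nat, #|[set u in S | (u \notin C) && Q (p u)]| <=
                        #|[set r in R | Q (p r)]|) ->
  y \in S -> y \in C ->
  exists b, [/\ b < L.*2,
    #|[set r in R | 0 < off b (p r) < L]| <= h,
    #|[set r in R | L < off b (p r)]| <= h &
    almost_in_half L (fun u => off b (p u)) S].
Proof.
move=> spS cardS Rh roots yS yC; have [pl _ _] := spS.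
pose q u := off (p y) (p u).
have ql u : q u < L.*2 by apply: off_lt.
have spq : spread C L q S by apply: spread_off.
have qy : q y = 0 by rewrite /q /off leqnn subnn.
have [a [aL win]] := others_in_window spq h_gt0 cardS yS yC qy.
have [z zoff] := others_off_circle spq h_gt0 cardS yS yC qy.
have [|j jL [jR jLe]] := @balanced_point q R a ql aL Rh.
  (* All robots except [y] and [z] are off the circle and in the window: at least [h + 1] of them,
     hence as many roots. *)
  apply: leq_trans (roots (fun i => a <= off (p y) i < a + L)).
  have: S :\ y :\ z \subset
      [set u in S | (u \notin C) && (a <= off (p y) (p u) < a + L)].
    apply/subsetP => u; rewrite !inE => /and3P[uz uy uS].
    by rewrite uS zoff //= win.
  move=> /subset_leq_card; apply: leq_trans.
  have := cardsD1 z (S :\ y); have := cardsD1 y S; rewrite yS.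
  by move: cardS; case: (z \in _); clear; lia.
have [||d dl dE] := @off_off (p y) (a + j) => //.
  by move: aL jL; clear; lia.
have dE' u : off (a + j) (q u) = off d (p u) by apply: dE.
exists d; split=> //.
- by rewrite (eq_card (B := [set r in R | 0 < off (a + j) (q r) < L])) // => r; rewrite !inE dE'.
- by rewrite (eq_card (B := [set r in R | L < off (a + j) (q r)])) // => r; rewrite !inE dE'.
(* Seen from [a + j], the window ends at [L - j.+1]. *)
exists y, (L - j.+1); split=> //; split; first by move: jL; clear; lia.
move=> u uS uy; rewrite -dE'; have := win u uS uy; move: jL; clear.
by rewrite /off; case: (leqP (a + j) (q u)); lia.
Qed.

End Rotation.

(** * The upper bound *)

Section UpperBound.
Variables (T : finType) (e : rel T) (c : seq T).
Hypothesis e_sym : symmetric e.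
Hypothesis e_conn : connected_graph e.
Hypothesis uc : unique_cycle e c.
Hypothesis c_even : ~~ odd (size c).

Let L := (size c)./2.
Let cL : size c = L.*2. Proof. by rewrite -[LHS]odd_double_half (negbTE c_even). Qed.
Let C := [set x in c].
Let p := cpos e c.
Let R := [set x in c | 3 <= deg e x].

Lemma gp_set_spread S : gp_set e S -> {in S &, injective (proj e c)} ->
  spread C L p S.
Proof.
move=> gS Sinj; have pl u : p u < L.*2 by rewrite -cL; apply: cpos_lt.
split=> //.
  move=> u v uS vS E; apply: Sinj => //.
  have [uc' _] := projP e_conn uc u; have [vc' _] := projP e_conn uc v.
  by have := congr1 (nth u c) E; rewrite /p /cpos !nth_index.
move=> u v w uS vS wS; rewrite inE => vC; split.
  move=> uvw; rewrite ltnNge; apply/negP => le.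
  apply: (@gp_set_cyclic _ e c u e_sym e_conn uc S u v w (p v - p u) (p w - p u)) => //.
  - by move: uvw; clear; lia.
  - by rewrite cL; move: le; clear; lia.
  - rewrite -/(p u) -/(p v) subnKC ?modn_small ?cL //; move: uvw; clear; lia.
  - rewrite -/(p u) -/(p w) subnKC ?modn_small ?cL //; move: uvw; clear; lia.
move=> uw uvw; rewrite ltnNge; apply/negP => le.
have [ul wl vl] := And3 (pl u) (pl w) (pl v).
(* The arc from [w] to [u] through position 0. *)
apply: (@gp_set_cyclic _ e c u e_sym e_conn uc S w v u
  (if p w < p v then p v - p w else p v + L.*2 - p w) (p u + L.*2 - p w)) => //.
- by move: uvw uw ul wl vl; clear; case: (ltnP (p w) (p v)); lia.
- by rewrite cL; move: le wl; clear; lia.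
- rewrite -/(p w) -/(p v) cL; case: ltnP => wv.
    by rewrite subnKC ?modn_small // ltnW.
  by rewrite subnKC ?modnDr ?modn_small //; move: wl; clear; lia.
- by rewrite -/(p w) -/(p u) cL subnKC ?modnDr ?modn_small //; move: wl; clear; lia.
Qed.

(** Robots off the cycle project injectively to roots, without change of position. *)
Lemma robots_le_roots (S : {set T}) (Q : pred nat) : {in S &, injective (proj e c)} ->
  #|[set u in S | (u \notin C) && Q (p u)]| <= #|[set r in R | Q (p r)]|.
Proof.
move=> Sinj; rewrite -(card_in_imset (f := proj e c)).
  apply/subset_leq_card/subsetP => r /imsetP[u].
  rewrite !inE => /and3P[uS uc' Qu] ->; have [pc _] := projP e_conn uc u.
  rewrite pc (tree_vertex_root u e_sym e_conn uc uc') /=.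
  by rewrite /p /cpos (proj_id e_sym e_conn uc pc).
by move=> u v; rewrite !inE => /andP[uS _] /andP[vS _]; apply: Sinj.
Qed.

Lemma mobile_card_bound S : 2 <= k_cyc e c -> ~~ odd (k_cyc e c) ->
  mobile_gp_set e S -> #|S| <= (k_cyc e c)./2 + 2.
Proof.
move=> k2 kev [gS [ss [moves visits]]].
set h := (k_cyc e c)./2; rewrite leqNgt; apply/negP => big.
have kh : k_cyc e c = h.*2 by rewrite -[LHS]odd_double_half (negbTE kev).
have h0 : 0 < h by move: k2; rewrite kh; clear; lia.
have big' : h + 3 <= #|S| by move: big; clear; lia.
have card3 : 3 <= #|S| by apply: leq_trans big'; rewrite leq_addl.
have inj := states_proj_inj e_sym e_conn uc gS moves visits card3.
have gp := states_gp e_sym gS moves.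
have card S' : S' \in S :: ss -> h + 3 <= #|S'|.
  by move=> S'in; rewrite (states_card e_sym gS moves S'in).
have sp S' : S' \in S :: ss -> spread C L p S'.
  by move=> S'in; apply: gp_set_spread; [apply: gp | apply: inj].
have [x xc] : exists x, x \in c.
  by case: uc => -[_ + _] _; case: (c) => // x; exists x; rewrite mem_head.
have [S1 [S1in xS1]] := visits x.
have xC : x \in C by rewrite inE.
have Rh : #|R| <= h.*2 by rewrite -kh.
have [b [bl bR bL KS1]] := balanced_half_exists h0 (sp _ S1in) (card _ S1in) Rh
  (fun Q => robots_le_roots Q (inj _ S1in)) xS1 xC.
pose q u := off L b (p u).
have spq S' : S' \in S :: ss -> spread C L q S'.
  by move=> S'in; apply: spread_off => //; apply: sp.
(* The origin [b] balances the fixed set of roots, so every state is balanced. *)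
have bal S' : S' \in S :: ss -> balanced C L h q S'.
  move=> S'in; split.
    exact: leq_trans (robots_le_roots (fun i => 0 < off L b i < L) (inj _ S'in)) bR.
  exact: leq_trans (robots_le_roots (fun i => L < off L b i) (inj _ S'in)) bL.
have [S2 [S2in yS2]] := visits (nth x c b).
have yc : nth x c b \in c by rewrite mem_nth // cL.
have KS2 : almost_in_half L q S2.
  apply: (mobile_invariant e_sym (P := almost_in_half L q) gS moves _ S1in S2in KS1).
  move=> S3 S4 S3in S4in [_ _ [u [v [uS vS euv S4E]]]] KS3.
  case: (proj_edge e_sym e_conn uc euv) => [uv|[uc' vc']].
    have quv : q u = q v by rewrite /q /p /cpos uv.
    have [w [s [wS [sL H]]]] := KS3.
    (* A move inside a branch changes no position; only the name of the exceptional robot may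
       change. *)
    exists (if w == u then v else w), s; split.
      by case: (eqVneq w u) => wu; rewrite S4E !inE ?eqxx // wu wS orbT.
    split=> // t; rewrite S4E !inE.
    case: (eqVneq w u) => wu /orP[/eqP->|/andP[tu tS]] tw.
    - by rewrite eqxx in tw.
    - by apply: H => //; rewrite wu.
    - by rewrite -quv; apply: H; rewrite // eq_sym.
    - exact: H.
  have uC : u \in C by rewrite inE.
  (* A robot moving along the cycle is first made the exceptional one, so its destination is
     irrelevant. *)
  have [s [sL H]] := on_circle_in_half (spq _ S3in) (bal _ S3in) h0
    (card _ S3in) KS3 uS uC.
  exists v, s; rewrite S4E setU11; split=> //; split=> // t.
  by rewrite !inE => /orP[->//|/andP[tu tS]] _; apply: H.
have yC : nth x c b \in C by rewrite inE.
apply: (origin_free (spq _ S2in) (bal _ S2in) h0 (card _ S2in) KS2 yS2 yC).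
have [[c_uniq _ _] _] := uc.
by rewrite /q /p /cpos (proj_id e_sym e_conn uc yc) index_uniq ?cL // /off leqnn subnn.
Qed.

End UpperBound.

(** * Tightness *)

Section GraphMetric.
Variables (T : finType) (e : rel T) (d : T -> T -> nat).
Hypothesis d_edge : forall x y, e x y -> d x y <= 1.
Hypothesis d_refl : forall x, d x x = 0.
Hypothesis d_triangle : forall x y z, d x z <= d x y + d y z.
Hypothesis d_step : forall x z, x != z -> exists2 y, e x y & d x z = (d y z).+1.

Lemma metric_path x z : exists p, [/\ path e x p, last x p = z & size p = d x z].
Proof.
move: {2}(d x z) (erefl (d x z)) => n; elim: n x => [|n IH] x dn.
  exists [::]; split; rewrite ?dn //=; apply/eqP/negPn/negP => /d_step[y _].
  by rewrite dn.
have xz : x != z by apply: contra_eqN dn => /eqP->; rewrite d_refl.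
have [y exy dy] := d_step xz; have [|p [pP pz ps]] := IH y.
  by move: dy; rewrite dn => -[].
by exists (y :: p); split; rewrite //= ?exy ?ps.
Qed.

Lemma metric_connected : connected_graph e.
Proof. by move=> x y; have [p [pP py _]] := metric_path x y; apply/connectP; exists p. Qed.

Lemma metric_nth x p i j : path e x p -> i <= j <= size p ->
  d (nth x (x :: p) i) (nth x (x :: p) j) <= j - i.
Proof.
move=> /(pathP x) pP; elim: j => [|j IH] /andP[ij jp].
  by move: ij; rewrite leqn0 => /eqP->; rewrite d_refl.
case: (ltngtP i j.+1) ij => // [ij|->] _; last by rewrite d_refl.
apply: leq_trans (d_triangle _ (nth x (x :: p) j) _) _.
have := d_edge (pP j jp); have := IH; rewrite (ltnW jp) andbT => /(_ ij).
by rewrite [nth x (x :: p) j.+1]/=; lia.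
Qed.

(** Each piece of the path has [d] at most its length; by the triangle inequality a strict
    inequality would make the whole path too long. *)
Lemma shortest_path_metric x p i j : shortest_path e (x :: p) ->
  i <= j <= size p -> d (nth x (x :: p) i) (nth x (x :: p) j) = j - i.
Proof.
move=> [pP pmin] ij; apply/eqP; rewrite eqn_leq metric_nth // andTb.
have [q [qP qlast qd]] := metric_path x (last x p).
have := pmin q qP qlast; rewrite qd.
have := @metric_nth x p 0 i pP; have := @metric_nth x p j (size p) pP.
have -> : nth x (x :: p) (size p) = last x p by exact: (nth_last x (x :: p)).
have := d_triangle x (nth x (x :: p) i) (last x p).
have := d_triangle (nth x (x :: p) i) (nth x (x :: p) j) (last x p).
rewrite [nth x (x :: p) 0]/=; lia.
Qed.

(** Of three vertices on a shortest path, the middle one gives equality in the triangle inequality;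
    the cases are the six orders. *)
Lemma metric_gp_set (S : {set T}) :
  (forall u v w, u \in S -> v \in S -> w \in S -> u != v -> v != w -> u != w ->
    d u v + d v w != d u w) -> gp_set e S.
Proof.
move=> ok u v w uS vS wS uv vw uw [[|x p] [sp us vs ws]] //.
have idx z : z \in x :: p -> exists2 i, i <= size p & nth x (x :: p) i = z.
  by move=> zs; exists (index z (x :: p)); rewrite ?nth_index // -ltnS index_mem.
have [i il iE] := idx u us; have [j jl jE] := idx v vs.
have [l ll lE] := idx w ws.
have D a b : a <= b <= size p -> d (nth x (x :: p) a) (nth x (x :: p) b) = b - a.
  exact: shortest_path_metric.
have between a b m : a <= b -> b <= m -> m <= size p ->
    d (nth x (x :: p) a) (nth x (x :: p) b) +
    d (nth x (x :: p) b) (nth x (x :: p) m) == d (nth x (x :: p) a) (nth x (x :: p) m).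
  move=> ab bm ms; have am := leq_trans ab bm.
  rewrite !D ?ab ?bm ?am ?ms ?(leq_trans bm ms) //.
  by rewrite addnC addnBA // subnK.
have vu : v != u by rewrite eq_sym.
have wv : w != v by rewrite eq_sym.
have wu : w != u by rewrite eq_sym.
have [uvw uwv wuv] := And3 (ok u v w) (ok u w v) (ok w u v).
have [vuw vwu wvu] := And3 (ok v u w) (ok v w u) (ok w v u).
case/orP: (leq_total i j) => ij; case/orP: (leq_total j l) => jl'.
- by move: uvw; rewrite -iE -jE -lE between ?iE ?jE ?lE // => /(_ uS vS wS uv vw uw).
- case/orP: (leq_total i l) => il'.
    by move: uwv; rewrite -iE -jE -lE between ?iE ?jE ?lE // => /(_ uS wS vS uw wv uv).
  by move: wuv; rewrite -iE -jE -lE between ?iE ?jE ?lE // => /(_ wS uS vS wu uv wv).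
- case/orP: (leq_total i l) => il'.
    by move: vuw; rewrite -iE -jE -lE between ?iE ?jE ?lE // => /(_ vS uS wS vu uw vw).
  by move: vwu; rewrite -iE -jE -lE between ?iE ?jE ?lE // => /(_ vS wS uS vw wu vu).
- by move: wvu; rewrite -iE -jE -lE between ?iE ?jE ?lE // => /(_ wS vS uS wv vu wu).
Qed.

End GraphMetric.

(** * The extremal example, checked by computation *)

Lemma all_iota_ord n (P : pred nat) : all P (iota 0 n) -> forall i : 'I_n, P i.
Proof. by move=> /allP allP i; apply: allP; rewrite mem_iota ltn_ord. Qed.

Lemma card_ord_count n (P : pred nat) : #|[set i : 'I_n | P i]| = count P (iota 0 n).
Proof. by rewrite -sum1dep_card -(big_mkord P (fun _ => 1)) sum1_count /index_iota subn0. Qed.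

(* The 4-cycle 0123 with a leaf 4 at 0 and a leaf 5 at 1. *)
Definition ex_adj (i j : nat) : bool :=
  let E := [:: (0, 1); (1, 2); (2, 3); (3, 0); (0, 4); (1, 5)] in
  ((i, j) \in E) || ((j, i) \in E).

Definition ex_dist (i j : nat) : nat :=
  nth 0 (nth [::] [:: [:: 0; 1; 2; 1; 1; 2];
                      [:: 1; 0; 1; 2; 2; 1];
                      [:: 2; 1; 0; 1; 3; 2];
                      [:: 1; 2; 1; 0; 2; 3];
                      [:: 1; 2; 3; 2; 0; 3];
                      [:: 2; 1; 2; 3; 3; 0]] i) j.

Definition ex_rel : rel 'I_6 := fun i j => ex_adj i j.

Definition ex_cycle : seq 'I_6 :=
  [:: @Ordinal 6 0 isT; @Ordinal 6 1 isT; @Ordinal 6 2 isT; @Ordinal 6 3 isT].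

Definition ex_set (l : seq nat) : {set 'I_6} := [set i : 'I_6 | (i : nat) \in l].

Lemma ex_rel_sym : symmetric ex_rel.
Proof. by move=> i j; rewrite /ex_rel /ex_adj orbC. Qed.

Lemma ex_rel_irr : irreflexive ex_rel.
Proof.
move=> i; apply/negbTE; apply: (@all_iota_ord 6 (fun i => ~~ ex_adj i i)).
by vm_compute.
Qed.

Lemma ex_dist_edge (x y : 'I_6) : ex_rel x y -> ex_dist x y <= 1.
Proof.
apply/implyP; apply: (@all_iota_ord 6 (fun i => ex_adj i y ==> (ex_dist i y <= 1))).
apply: (@all_iota_ord 6 (fun j => all (fun i => ex_adj i j ==> (ex_dist i j <= 1)) (iota 0 6))).
by vm_compute.
Qed.

Lemma ex_dist_refl (x : 'I_6) : ex_dist x x = 0.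
Proof.
apply/eqP; apply: (@all_iota_ord 6 (fun i => ex_dist i i == 0)).
by vm_compute.
Qed.

Lemma ex_dist_triangle (x y z : 'I_6) : ex_dist x z <= ex_dist x y + ex_dist y z.
Proof.
pose P i j k := ex_dist i k <= ex_dist i j + ex_dist j k.
apply: (@all_iota_ord 6 (P x y)).
apply: (@all_iota_ord 6 (fun j => all (P x j) (iota 0 6))).
apply: (@all_iota_ord 6 (fun i => all (fun j => all (P i j) (iota 0 6)) (iota 0 6))).
by vm_compute.
Qed.

Lemma ex_dist_step (x z : 'I_6) : x != z ->
  exists2 y, ex_rel x y & ex_dist x z = (ex_dist y z).+1.
Proof.
pose P i k := (i != k) ==>
  has (fun j => ex_adj i j && (ex_dist i k == (ex_dist j k).+1)) (iota 0 6).
have: P x z.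
  apply: (@all_iota_ord 6 (P x)).
  apply: (@all_iota_ord 6 (fun i => all (P i) (iota 0 6))).
  by vm_compute.
move=> /implyP H xz; case/hasP: (H xz) => j; rewrite mem_iota => jl /andP[xj /eqP dj].
by exists (@Ordinal 6 j jl).
Qed.

Lemma ex_connected : connected_graph ex_rel.
Proof. exact: metric_connected ex_dist_refl ex_dist_step. Qed.

Definition ex_gp (l : seq nat) : bool :=
  all (fun u => all (fun v => all (fun w =>
    [|| u == v, v == w, u == w | ex_dist u v + ex_dist v w != ex_dist u w]) l) l) l.

Lemma ex_gpP l : ex_gp l -> gp_set ex_rel (ex_set l).
Proof.
move=> /allP ok; apply: (metric_gp_set ex_dist_edge ex_dist_refl ex_dist_triangle ex_dist_step).
move=> u v w; rewrite !inE => ul vl wl uv vw uw.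
have /allP/(_ _ vl)/allP/(_ _ wl) := ok _ ul.
by rewrite -!(inj_eq val_inj) in uv vw uw; rewrite (negbTE uv) (negbTE vw) (negbTE uw).
Qed.

Lemma ex_move (l l' : seq nat) (x y : 'I_6) :
  [&& (x : nat) \in l, (y : nat) \notin l, ex_adj x y & ex_gp l'] ->
  all (fun i => (i \in l') == (i == y :> nat) || (i != x :> nat) && (i \in l)) (iota 0 6) ->
  legal_move ex_rel (ex_set l) (ex_set l').
Proof.
move=> /and4P[xl yl xy gl] /all_iota_ord sets; exists x, y; split; rewrite ?inE //.
  by apply/setP => i; rewrite !inE (eqP (sets i)) -!(inj_eq val_inj).
exact: ex_gpP.
Qed.

Lemma ex_mobile : mobile_gp_set ex_rel (ex_set [:: 0; 2; 5]).
Proof.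
split; first by apply: ex_gpP; vm_compute.
(* The moves are 0 to 4, 2 to 3 and 5 to 1; the first and last states together cover all six
   vertices. *)
exists [:: ex_set [:: 2; 4; 5]; ex_set [:: 3; 4; 5]; ex_set [:: 1; 3; 4]]; split.
  case=> [|[|[|//]]] _ /=.
  - by apply: (@ex_move _ _ (@Ordinal 6 0 isT) (@Ordinal 6 4 isT)); vm_compute.
  - by apply: (@ex_move _ _ (@Ordinal 6 2 isT) (@Ordinal 6 3 isT)); vm_compute.
  - by apply: (@ex_move _ _ (@Ordinal 6 5 isT) (@Ordinal 6 1 isT)); vm_compute.
move=> v; have : (v : nat) \in [:: 0; 2; 5] ++ [:: 1; 3; 4].
  apply: (@all_iota_ord 6 (fun v => v \in [:: 0; 2; 5] ++ [:: 1; 3; 4])).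
  by vm_compute.
rewrite mem_cat => /orP[] vl.
  by exists (ex_set [:: 0; 2; 5]); rewrite mem_head inE.
by exists (ex_set [:: 1; 3; 4]); rewrite !in_cons eqxx !orbT inE.
Qed.

Lemma ex_k_cyc : k_cyc ex_rel ex_cycle = 2.
Proof.
have degE x : deg ex_rel x = count (ex_adj x) (iota 0 6) by apply: card_ord_count.
rewrite /k_cyc -[RHS]/(count (fun i => (i \in iota 0 4) &&
  (3 <= count (ex_adj i) (iota 0 6))) (iota 0 6)) -card_ord_count.
apply: eq_card => x; rewrite !in_set degE.
by congr (_ && _).
Qed.

Lemma ex_is_cycle : is_cycle ex_rel ex_cycle.
Proof. by split; vm_compute. Qed.

Fixpoint words (n : nat) : seq (seq nat) :=
  if n is m.+1 then [seq i :: s | i <- iota 0 4, s <- words m] else [:: [::]].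

Lemma mem_words s : all (fun i => i < 4) s -> s \in words (size s).
Proof.
elim: s => // i s IH /andP[i4 /IH sw].
by apply: (allpairs_f cons) => //; rewrite mem_iota.
Qed.

(* A vertex of a cycle has two distinct neighbours, so a cycle avoids the
   leaves; the remaining finitely many words are checked by computation. *)
Lemma ex_unique_cycle : unique_cycle ex_rel ex_cycle.
Proof.
split; first exact: ex_is_cycle.
move=> c' [c'_uniq c'_size c'_cycle].
have lt4 x : x \in c' -> (x : nat) < 4.
  move=> /rot_to[i q rotE]; rewrite ltnNge; apply/negP => x4.
  move: c'_uniq c'_size c'_cycle; rewrite -(rot_uniq i) -(size_rot i) -(rot_cycle i) rotE.
  case: q {rotE} => [|y q] //; case/lastP: q => [|q z] //=.
  rewrite rcons_path mem_rcons last_rcons inE negb_or => + _.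
  move=> /and3P[_ /andP[yz _] _] /and3P[xy _ zx]; case/eqP: yz.
  pose P i j k := (4 <= i) && ex_adj i j && ex_adj k i ==> (j == k).
  have /implyP : P x y z.
    apply: (@all_iota_ord 6 (P x y)).
    apply: (@all_iota_ord 6 (fun j => all (P x j) (iota 0 6))).
    apply: (@all_iota_ord 6 (fun i => all (fun j => all (P i j) (iota 0 6)) (iota 0 6))).
    by vm_compute.
  by rewrite x4 -/(ex_rel x y) xy -/(ex_rel z x) zx => /(_ isT) /eqP /val_inj.
pose s := map val c'.
have s4 : all (fun i => i < 4) s by rewrite all_map; apply/allP.
have s_uniq : uniq s by rewrite map_inj_uniq //; apply: val_inj.
(* A repetition-free word over the four cycle vertices has length at most 4, so two word lengths
   remain to be enumerated. *)
have s_size : size s \in [:: 3; 4].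
  have : size s <= size (iota 0 4).
    by apply: uniq_leq_size => // i /(allP s4); rewrite mem_iota.
  move: c'_size; rewrite -(size_map val) -/s size_iota !inE; clear.
  by case: (size s) => [|[|[|[|[|]]]]].
have s_cycle : cycle ex_adj s.
  by rewrite /s; case: (c') c'_cycle => //= a q; rewrite -map_rcons path_map.
pose ok (t : seq nat) := [&& uniq t, size t \in [:: 3; 4] & cycle ex_adj t] ==>
  has (fun i => (t == rot i (iota 0 4)) || (t == rot i (rev (iota 0 4)))) (iota 0 4).
have /implyP : ok s.
  have words_ok : all ok (words 3) && all ok (words 4) by vm_compute.
  case/andP: words_ok => /allP w3 /allP w4; have := mem_words s4.
  by move: s_size; rewrite !inE => /orP[] /eqP -> ; [apply: w3 | apply: w4].
rewrite s_uniq s_size s_cycle => /(_ isT) /hasP[i _ siE].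
by exists i; case/orP: siE => /eqP siE; [left | right];
  apply: (inj_map val_inj); rewrite -/s siE map_rot ?map_rev.
Qed.

Theorem theorem2p4 :
  (forall (T : finType) (e : rel T) (c : seq T),
      simple_graph e -> connected_graph e -> unique_cycle e c ->
      2 <= k_cyc e c -> ~~ odd (k_cyc e c) -> ~~ odd (size c) ->
      forall S : {set T}, mobile_gp_set e S -> #|S| <= (k_cyc e c)./2 + 2)
  /\
  (exists (T : finType) (e : rel T) (c : seq T),
      simple_graph e /\ connected_graph e /\ unique_cycle e c /\
      2 <= k_cyc e c /\ ~~ odd (k_cyc e c) /\ ~~ odd (size c) /\
      is_mob e ((k_cyc e c)./2 + 2)).
Proof.
split.
  move=> T e c [e_sym _] e_conn uc k2 kev cev S.
  exact: mobile_card_bound.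
have [k2 kev cev] : [/\ 2 <= k_cyc ex_rel ex_cycle,
    ~~ odd (k_cyc ex_rel ex_cycle) & ~~ odd (size ex_cycle)].
  by rewrite ex_k_cyc.
exists 'I_6, ex_rel, ex_cycle.
split; first by split; [apply: ex_rel_sym | apply: ex_rel_irr].
split; first exact: ex_connected.
split; first exact: ex_unique_cycle.
do 3 split=> //.
split; last first.
  move=> S; apply: mobile_card_bound => //.
  - exact: ex_rel_sym.
  - exact: ex_connected.
  - exact: ex_unique_cycle.
(* Two roots give the value 3, attained by this set. *)
exists (ex_set [:: 0; 2; 5]); split; first exact: ex_mobile.
by rewrite ex_k_cyc card_ord_count.
Qed.
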